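(* Let $A\in\mathbb{R}^{n\times n}$ be a nonsingular symmetric indefinite matrix, let $T\in\mathbb{R}^{n\times n}$ be symmetric positive definite (SPD), and let $f\in\mathbb{R}^n$. Assume that the spectrum of $TA$ is enclosed within a pair of intervals $[a,b]\cup[c,d]$ of equal length ($b-a=d-c$), where $a\le b<0<c\le d$. Given any initial guess $x^{(0)}\in\mathbb{R}^n$, consider the iteration $$x^{(i+1)}=x^{(i)}+\beta^{(i)}Tr^{(i)}+\alpha^{(i)}TATr^{(i)},\qquad r^{(i)}=f-Ax^{(i)},\qquad i=0,1,\ldots,$$ where the real parameters $\alpha^{(i)},\beta^{(i)}$ are chosen at each step so that $$\|r^{(i+1)}\|_T=\min_{u\in\operatorname{span}\{Tr^{(i)},\,TATr^{(i)}\}}\|r^{(i)}-Au\|_T .$$ Then the iterates $x^{(i)}$ converge to the solution $A^{-1}f$ of $Ax=f$, and for every $i$ with $r^{(i)}\ne 0$ $$\frac{\|r^{(i+1)}\|_T}{\|r^{(i)}\|_T}\le\frac{|ad|-|bc|}{|ad|+|bc|}.$$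
   Context: $(\cdot,\cdot)$ is the Euclidean inner product on $\mathbb{R}^n$, and for the SPD matrix $T$, $\|v\|_T=(v,Tv)^{1/2}$. A symmetric matrix is indefinite if it has both positive and negative eigenvalues. All eigenvalues of $TA$ are real. *)

(* Defs.v *)
From mathcomp Require Import all_boot all_order all_algebra.
From mathcomp Require Import all_classical all_reals all_analysis.

Set Implicit Arguments.
Unset Strict Implicit.
Unset Printing Implicit Defensive.

Import Order.TTheory GRing.Theory Num.Theory.
Import numFieldNormedType.Exports.

Local Open Scope classical_set_scope.
Local Open Scope ring_scope.

Definition dotcv (R : realType) (n : nat) (u v : 'cV[R]_n) : R :=
  (u^T *m v) 0 0.

Definition spdmx (R : realType) (n : nat) (T : 'M[R]_n) : Prop :=
  T^T = T /\ forall v : 'cV[R]_n, v != 0 -> 0 < dotcv v (T *m v).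

Definition normT (R : realType) (n : nat) (T : 'M[R]_n) (v : 'cV[R]_n) : R :=
  Num.sqrt (dotcv v (T *m v)).

Definition indefinitemx (R : realType) (n : nat) (A : 'M[R]_n) : Prop :=
  (exists2 l : R, 0 < l & eigenvalue A l) /\
  (exists2 l : R, l < 0 & eigenvalue A l).

Definition is_minimum (R : realType) (S : set R) (m : R) : Prop :=
  S m /\ lbound S m.

(* Main.v *)
Require Import Defs.
From mathcomp Require Import all_boot all_order all_algebra.
From mathcomp Require Import all_classical all_reals all_analysis.
From mathcomp Require Import complex ring lra.

(** The residual satisfies [r (i+1) = r i - A u] for a vector [u] that is
optimal in the span of [T r] and [T A T r], so it is enough to exhibit one
good [u].  Since [b - a = d - c], the quadratic [l ^ 2 - (b + c) l] equals
[|bc|] at both inner endpoints [b], [c] and [|ad|] at both outer endpoints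
[a], [d]; on the two intervals it therefore lies between [|bc|] and [|ad|].
The polynomial
  [p l = 1 - 2 / (|ad| + |bc|) * (l ^ 2 - (b + c) l)],
which has [p 0 = 1], is then bounded on the spectrum by
[rho = (|ad| - |bc|) / (|ad| + |bc|) < 1], and the vector [u] for which
[r - A u = p(A T) r] lies in the span.

The bound [normT T (p(A T) r) <= rho * normT T r] is the spectral theorem in
the [T]-inner product ([selfadj_horner_normT_le]).  It rests on
diagonalizability of a matrix [G] with [G T = T G^T]
([selfadj_diagonalizable]): the minimal polynomial of [G] splits over the
reals because its complex roots are real, and it has simple roots because a
nilpotent self-adjoint matrix vanishes.  Once [P G = D P] with [D] diagonal,
no orthonormal basis is needed: the Gram matrix [H = P T P^T] commutes with
[D], which makes [rho ^ 2 H - p(D) H p(D)] a congruence [E H E] of [H] with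
[E] diagonal, hence positive.

Convergence follows: the norms of the residuals decay geometrically, and by
Cauchy-Schwarz in the [T]-inner product each coordinate of [A^-1 r i] is
bounded by a constant multiple of [normT T (r i)]. *)

Import Order.TTheory GRing.Theory Num.Theory.
Import numFieldNormedType.Exports.

Local Open Scope classical_set_scope.
Local Open Scope ring_scope.

(** * The inner product of a symmetric positive definite matrix *)

Section EnergyForm.
Context {R : realType} {n : nat}.
Implicit Types (T M : 'M[R]_n) (u v w : 'cV[R]_n).

Lemma dotcvDl u v w : dotcv (u + v) w = dotcv u w + dotcv v w.
Proof. by rewrite /dotcv linearD mulmxDl mxE. Qed.

Lemma dotcvDr u v w : dotcv w (u + v) = dotcv w u + dotcv w v.
Proof. by rewrite /dotcv mulmxDr mxE. Qed.

Lemma dotcvZl k u v : dotcv (k *: u) v = k * dotcv u v.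
Proof. by rewrite /dotcv linearZ -scalemxAl mxE. Qed.

Lemma dotcvZr k u v : dotcv u (k *: v) = k * dotcv u v.
Proof. by rewrite /dotcv -scalemxAr mxE. Qed.

Lemma dotcvC u v : dotcv u v = dotcv v u.
Proof.
by rewrite /dotcv -[in LHS](trmxK v) -trmx_mul mxE.
Qed.

Lemma dotcv_mulmxl M u v : dotcv (M *m u) v = dotcv u (M^T *m v).
Proof. by rewrite /dotcv trmx_mul mulmxA. Qed.

Lemma dotcv0r u : dotcv u 0 = 0.
Proof. by rewrite /dotcv mulmx0 mxE. Qed.

Lemma spd_ge0 T v : spdmx T -> 0 <= dotcv v (T *m v).
Proof.
move=> [_ Tpos]; have [->|v0] := eqVneq v 0; first by rewrite mulmx0 dotcv0r.
exact/ltW/Tpos.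
Qed.

Lemma spd_eq0 T v : spdmx T -> dotcv v (T *m v) = 0 -> v = 0.
Proof.
move=> [_ Tpos] v0; apply/eqP/negPn/negP => /Tpos.
by rewrite v0 ltxx.
Qed.

Lemma normT_ge0 T v : 0 <= normT T v.
Proof. exact: sqrtr_ge0. Qed.

Lemma sqr_normT T v : spdmx T -> normT T v ^+ 2 = dotcv v (T *m v).
Proof. by move=> Tspd; rewrite sqr_sqrtr// spd_ge0. Qed.

Lemma spd_unitmx T : spdmx T -> T \in unitmx.
Proof.
move=> Tspd; rewrite -row_full_unit -[_ T]/(\rank T == n)%N -mxrank_tr.
rewrite -[_ == _]/(row_free T^T) -kermx_eq0.
apply/eqP/row_matrixP => i; rewrite row0; apply: trmx_inj; rewrite trmx0.
apply: (@spd_eq0 T) => //.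
have : row i (kermx T^T) *m T^T = 0 by rewrite -row_mul mulmx_ker row0.
by move/(congr1 trmx); rewrite trmx_mul trmxK trmx0 => ->; rewrite dotcv0r.
Qed.

(** The vector [(v, v)_T u - (u, v)_T v] has squared norm
[(v, v)_T ((u, u)_T (v, v)_T - (u, v)_T ^ 2)]. *)
Lemma normT_Cauchy_Schwarz T u v : spdmx T ->
  `|dotcv u (T *m v)| <= normT T u * normT T v.
Proof.
move=> Tspd; have [->|v0] := eqVneq v 0.
  by rewrite mulmx0 dotcv0r normr0 mulr_ge0 ?normT_ge0.
have Tv_gt0 : 0 < dotcv v (T *m v) by apply Tspd.
have vuE : dotcv v (T *m u) = dotcv u (T *m v).
  by rewrite dotcvC dotcv_mulmxl (proj1 Tspd).
have := @spd_ge0 T (dotcv v (T *m v) *: u + - dotcv u (T *m v) *: v) Tspd.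
rewrite mulmxDr -!scalemxAr !dotcvDl !dotcvDr !dotcvZl !dotcvZr vuE.
move=> Q_ge0.
rewrite -ler_sqr ?nnegrE ?mulr_ge0 ?normT_ge0//.
rewrite exprMn !sqr_normT// real_normK ?num_real//.
by rewrite -subr_ge0 -(pmulr_rge0 _ Tv_gt0); apply: le_trans Q_ge0 _; lra.
Qed.

(** [M T = T M^T] says that [M^T] is self-adjoint for [(u, v)_T], so the squared
[T]-norm of [M^T e] is [(e, M^2 T e) = 0]. *)
Lemma selfadj_sqr0 T M : spdmx T -> M *m T = T *m M^T -> M *m M = 0 -> M = 0.
Proof.
move=> Tspd MT MM0; apply/row_matrixP => i; rewrite row0.
apply: trmx_inj; rewrite trmx0 tr_row; apply: (spd_eq0 T _ Tspd).
rewrite colE dotcv_mulmxl trmxK !mulmxA -(mulmxA M T) -MT mulmxA MM0.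
by rewrite !mul0mx dotcv0r.
Qed.

End EnergyForm.

(** * Spectral theory of self-adjoint matrices *)

Section SelfAdjoint.
Context {R : realType} {n' : nat}.
Notation n := n'.+1.
Implicit Types (T M G : 'M[R]_n) (p : {poly R}).

Lemma selfadj_horner T G p :
  G *m T = T *m G^T -> horner_mx G p *m T = T *m (horner_mx G p)^T.
Proof.
move=> GT; elim/poly_ind: p => [|p c IH].
  by rewrite rmorph0 trmx0 mulmx0 mul0mx.
rewrite rmorphD rmorphM /= horner_mx_X horner_mx_C.
have comm : horner_mx G p *m G = G *m horner_mx G p by exact: comm_horner_mx.
rewrite linearD /= tr_scalar_mx mulmxDl mulmxDr scalar_mxC; congr (_ + _).
by rewrite -[_ * G]/(_ *m G) {1}comm -mulmxA IH mulmxA GT -mulmxA -trmx_mul.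
Qed.

(** Powers of [M] are again self-adjoint, so [selfadj_sqr0] halves the exponent
from [2 ^ j] down to [1]. *)
Lemma selfadj_nilpotent T M k :
  spdmx T -> M *m T = T *m M^T -> M ^+ k = 0 -> M = 0.
Proof.
move=> Tspd MT; have MkT j : M ^+ j *m T = T *m (M ^+ j)^T.
  by have := selfadj_horner T _ ('X^j) MT; rewrite rmorphXn /= horner_mx_X.
have pow2 j : M ^+ (2 ^ j) = 0 -> M = 0.
  elim: j => [|j IH]; first by rewrite expr1.
  rewrite expnS mulnC exprM expr2 => Mj0; apply: IH.
  exact: (selfadj_sqr0 T _ Tspd (MkT _) Mj0).
move=> Mk0; apply: (pow2 k).
by rewrite -(subnK (ltnW (ltn_expl k (ltnSn 1)))) exprD Mk0 mulr0.
Qed.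

(** The usual Hermitian argument, carried out on real and imaginary parts: if
[(x + i y) G = z (x + i y)], then evaluating [(x G, y)_T = (x, y G)_T] gives
[Im z * ((x, x)_T + (y, y)_T) = 0]. *)
Lemma selfadj_complex_root T G (z : R[i]) : spdmx T -> G *m T = T *m G^T ->
  root (map_poly (real_complex R) (mxminpoly G)) z -> complex.Im z = 0.
Proof.
move=> Tspd GT.
rewrite -mxminpoly_map -eigenvalue_root_min => /eigenvalueP[w wG w0].
pose x := map_mx (@complex.Re R) w; pose y := map_mx (@complex.Im R) w.
have re_mul c (v : 'rV[R[i]]_n) :
  map_mx (@complex.Re R) (c *: v) =
    complex.Re c *: map_mx (@complex.Re R) v -
    complex.Im c *: map_mx (@complex.Im R) v.
  by apply/rowP => j; rewrite !mxE; case: c => ? ?; case: (v 0 j).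
have im_mul c (v : 'rV[R[i]]_n) :
  map_mx (@complex.Im R) (c *: v) =
    complex.Im c *: map_mx (@complex.Re R) v +
    complex.Re c *: map_mx (@complex.Im R) v.
  apply/rowP => j; rewrite !mxE; case: c => ? ?; case: (v 0 j) => ? ? /=.
  by rewrite addrC.
have re_mx (v : 'rV[R[i]]_n) :
  map_mx (@complex.Re R) (v *m map_mx (real_complex R) G) =
    map_mx (@complex.Re R) v *m G.
  apply/rowP => j; rewrite !mxE (raddf_sum (@complex.Re R : Rcomplex R -> R)).
  apply: eq_bigr => k _; rewrite !mxE; case: (v 0 k) => ? ? /=.
  by rewrite mulr0 subr0.
have im_mx (v : 'rV[R[i]]_n) :
  map_mx (@complex.Im R) (v *m map_mx (real_complex R) G) =
    map_mx (@complex.Im R) v *m G.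
  apply/rowP => j; rewrite !mxE (raddf_sum (@complex.Im R : Rcomplex R -> R)).
  apply: eq_bigr => k _; rewrite !mxE; case: (v 0 k) => ? ? /=.
  by rewrite mulr0 add0r.
have xG : x *m G = complex.Re z *: x + (- complex.Im z) *: y.
  by rewrite -re_mx wG re_mul scaleNr.
have yG : y *m G = complex.Im z *: x + complex.Re z *: y.
  by rewrite -im_mx wG im_mul.
have tr_comb (s t : R) (u v : 'rV[R]_n) :
  (s *: u + t *: v)^T = s *: u^T + t *: v^T by rewrite linearD !linearZ.
have sym : dotcv (x *m G)^T (T *m y^T) = dotcv x^T (T *m (y *m G)^T).
  by rewrite !trmx_mul dotcv_mulmxl trmxK !mulmxA GT.
have xy : dotcv y^T (T *m x^T) = dotcv x^T (T *m y^T).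
  by rewrite dotcvC dotcv_mulmxl (proj1 Tspd).
have : complex.Im z * (dotcv x^T (T *m x^T) + dotcv y^T (T *m y^T)) = 0.
  move: sym; rewrite xG yG !tr_comb mulmxDr -!scalemxAr.
  rewrite !dotcvDl !dotcvDr !dotcvZl !dotcvZr; lra.
move/eqP; rewrite mulf_eq0 => /orP[/eqP//|].
rewrite paddr_eq0 ?spd_ge0// => /andP[/eqP x0 /eqP y0].
have {}x0 : x = 0 by apply: trmx_inj; rewrite trmx0; apply: (spd_eq0 T).
have {}y0 : y = 0 by apply: trmx_inj; rewrite trmx0; apply: (spd_eq0 T).
case/eqP: w0; apply/rowP => j.
have /rowP/(_ j) := x0; have /rowP/(_ j) := y0.
by rewrite !mxE; case: (w 0 j) => ? ? /= -> ->.
Qed.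

(** The minimal polynomial is a product of real linear factors.  Let [q] be the
product of the distinct ones: [q(G)] is self-adjoint and nilpotent, hence zero,
so the minimal polynomial divides the separable [q]. *)
Lemma selfadj_diagonalizable T G : spdmx T -> G *m T = T *m G^T ->
  diagonalizable G.
Proof.
move=> Tspd GT; apply/diagonalizableP.
pose m := mxminpoly G.
have [zs mE] := closed_field_poly_normal (map_poly (real_complex R) m).
pose rs := [seq complex.Re z | z <- zs].
have {}mE : m = \prod_(r <- rs) ('X - r%:P).
  apply: (map_poly_inj (real_complex R)); rewrite mE.
  rewrite lead_coef_map (monicP (mxminpoly_monic G)) rmorph1 scale1r.
  rewrite rmorph_prod /= big_map; apply: eq_big_seq => z z_zs.
  rewrite rmorphB /= map_polyX map_polyC /=.
  have Imz : complex.Im z = 0.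
    apply: (selfadj_complex_root T G z Tspd GT).
    rewrite mE lead_coef_map (monicP (mxminpoly_monic G)) rmorph1 scale1r.
    by rewrite root_prod_XsubC.
  by case: z Imz {z_zs} => u v /= ->.
exists (undup rs); first exact: undup_uniq.
set q := \prod_(r <- undup rs) _.
have mq : m %| q ^+ size rs.
  suff dvd s : {subset s <= undup rs} ->
      \prod_(r <- s) ('X - r%:P) %| q ^+ size s.
    by rewrite mE; apply: dvd => r; rewrite mem_undup.
  elim: s => [|r s IH] sub; first by rewrite big_nil dvd1p.
  rewrite big_cons exprS dvdp_mul ?IH//; last first.
    by move=> t ts; apply: sub; rewrite inE ts orbT.
  by rewrite dvdp_XsubCl root_prod_XsubC sub// mem_head.
apply: mxminpoly_min; apply: (selfadj_nilpotent T _ (size rs)) => //.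
  exact: selfadj_horner.
by rewrite -rmorphXn /=; apply/mxminpoly_minP.
Qed.

(** [eigenvalue] refers to row eigenvectors, so [G] acts on rows and it is
[G^T] that acts on the columns measured by [normT].  For [G = T A] this
transpose is [A T], the matrix that acts on residuals. *)
Lemma selfadj_horner_normT_le T G p rho v : spdmx T -> G *m T = T *m G^T ->
  (forall l, eigenvalue G l -> `|p.[l]| <= rho) ->
  normT T ((horner_mx G p)^T *m v) <= rho * normT T v.
Proof.
move=> Tspd GT p_le.
have [P Punit /diagonalizable_forPex[D /(simmxP Punit) PG]] :=
  selfadj_diagonalizable T G Tspd GT.
have D_le i : `|p.[D 0 i]| <= rho.
  apply: p_le; apply/eigenvalueP; exists (row i P).
    by rewrite -row_mul PG row_mul row_diag_mx -scalemxAl -rowE.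
  apply/eqP => Pi0; have /rowP/(_ i) : delta_mx 0 i = 0 :> 'rV[R]_n.
    by rewrite -(mulmxK Punit (delta_mx 0 i)) -rowE Pi0 mul0mx.
  by rewrite !mxE !eqxx => /eqP; rewrite oner_eq0.
have rho_ge0 : 0 <= rho := le_trans (normr_ge0 _) (D_le 0).
(* Gram matrix of the eigenbasis formed by the rows of P *)
pose H := P *m T *m P^T.
have DH : diag_mx D *m H = H *m diag_mx D.
  rewrite /H !mulmxA -PG -[_ *m G *m _]mulmxA GT !mulmxA -[LHS]mulmxA.
  by rewrite -trmx_mul PG trmx_mul tr_diag_mx !mulmxA.
have DH_ij i j : D 0 i != D 0 j -> H i j = 0.
  move=> Dij; have /matrixP/(_ i j) := DH.
  rewrite mul_diag_mx mul_mx_diag !mxE => /eqP.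
  by rewrite mulrC -subr_eq0 -mulrBr mulf_eq0 subr_eq0 (negPf Dij) orbF => /eqP.
pose z := (invmx P)^T *m v.
pose F := \row_i p.[D 0 i].
pose E := \row_i Num.sqrt (rho ^+ 2 - p.[D 0 i] ^+ 2).
have vE : v = P^T *m z.
  by rewrite /z mulmxA -trmx_mul mulVmx// trmx1 mul1mx.
have pvE : (horner_mx G p)^T *m v = P^T *m (diag_mx F *m z).
  have -> : horner_mx G p = invmx P *m diag_mx F *m P.
    have -> : G = invmx P *m diag_mx D *m P by rewrite -mulmxA -PG mulKmx.
    rewrite horner_mx_uconjC// horner_mx_diag; congr (_ *m diag_mx _ *m _).
    by apply/rowP => i; rewrite !mxE.
  by rewrite !trmx_mul tr_diag_mx /z !mulmxA.
have normP w : dotcv (P^T *m w) (T *m (P^T *m w)) = dotcv w (H *m w).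
  by rewrite dotcv_mulmxl trmxK !mulmxA.
(* Entrywise: off the blocks of equal eigenvalues H vanishes, and inside such a
   block both entries of F coincide, as do both entries of E. *)
have HE : rho ^+ 2 *: H - diag_mx F *m H *m diag_mx F =
    diag_mx E *m H *m diag_mx E.
  clear normP; clearbody H; apply/matrixP => i j.
  rewrite 2!mul_mx_diag 2!mul_diag_mx !mxE.
  have [<-|Dij] := eqVneq (D 0 i) (D 0 j); last first.
    by rewrite DH_ij// !(mulr0, mul0r) subrr.
  have E_ge0 : 0 <= rho ^+ 2 - p.[D 0 i] ^+ 2.
    by rewrite subr_ge0 -[leLHS]real_normK ?num_real// ler_sqr ?nnegrE.
  rewrite [RHS]mulrAC -expr2 sqr_sqrtr//; ring.
have diagP (d : 'rV[R]_n) : dotcv (diag_mx d *m z) (H *m (diag_mx d *m z)) =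
    dotcv z (diag_mx d *m H *m diag_mx d *m z).
  by rewrite dotcv_mulmxl tr_diag_mx !mulmxA.
have HEz : rho ^+ 2 * dotcv z (H *m z) -
    dotcv z (diag_mx F *m H *m diag_mx F *m z) =
    dotcv z (diag_mx E *m H *m diag_mx E *m z).
  rewrite -HE mulmxBl -scalemxAl dotcvDr dotcvZr; congr (_ + _).
  by rewrite -[X in _ = dotcv z X]scaleN1r dotcvZr mulN1r.
rewrite -ler_sqr ?nnegrE ?mulr_ge0 ?normT_ge0//.
rewrite exprMn !sqr_normT// pvE vE !normP -subr_ge0 diagP HEz -diagP -normP.
exact: spd_ge0.
Qed.

End SelfAdjoint.

(** * Convergence of vector sequences *)

Lemma mx_cvg_coord {R : realType} {m n : nat} (x : nat -> 'M[R]_(m, n))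
    (L : 'M[R]_(m, n)) :
  (forall i j, x k i j @[k --> \oo] --> L i j) -> x k @[k --> \oo] --> L.
Proof.
move=> xL A [P LP sPA]; apply: (@filterS _ \oo _ _ _ (fun k => sPA (x k))).
apply: (@filter_forall _ _ (fun i k => forall j, P i j (x k i j)) \oo) => i.
apply: (@filter_forall _ _ (fun j k => P i j (x k i j)) \oo) => j.
exact: xL (LP i j).
Qed.

(** Each coordinate of [B e] is a [T]-inner product [(w, e)_T] with a fixed [w],
to which Cauchy-Schwarz applies. *)
Lemma normT_cvg0 {R : realType} {n : nat} (T B : 'M[R]_n)
    (e : nat -> 'cV[R]_n) : spdmx T ->
  normT T (e k) @[k --> \oo] --> 0 -> B *m e k @[k --> \oo] --> (0 : 'cV[R]_n).
Proof.
move=> Tspd e0; apply: (mx_cvg_coord (fun k => B *m e k)) => i j.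
rewrite [X in _ --> X]mxE.
pose w := invmx T *m (row i B)^T.
have BeE k : (B *m e k) i j = dotcv w (T *m e k).
  rewrite dotcvC dotcv_mulmxl (proj1 Tspd) /w mulmxA mulmxV ?spd_unitmx// mul1mx.
  rewrite dotcvC /dotcv trmxK -row_mul !mxE.
  by apply: eq_bigr => l _; rewrite (ord1 j).
have we0 : normT T w * normT T (e k) @[k --> \oo] --> 0.
  by rewrite -[X in _ --> X](mulr0 (normT T w)); apply: cvgMr.
apply/norm_cvg0P; apply: (squeeze_cvgr _ (cvg_cst _) we0).
by apply: nearW => k /=; rewrite BeE normr_ge0 normT_Cauchy_Schwarz.
Qed.

(** * The two-parameter step and its contraction factor *)

Lemma normr_mulNP {R : realType} (s t : R) :
  s < 0 -> 0 < t -> `|s * t| = - (s * t).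
Proof. by move=> s0 t0; rewrite ltr0_norm// nmulr_rlt0. Qed.

(** Since [a + d = b + c], the lower bound is [(l - b) (l - c) >= 0] and the
upper bound is [(l - a) (l - d) <= 0]. *)
Lemma two_interval_quadratic_bound {R : realType} (a b c d l : R) :
  a <= b -> b < 0 -> 0 < c -> c <= d -> b - a = d - c ->
  l \in `[a, b] \/ l \in `[c, d] ->
  - (b * c) <= l ^+ 2 - (b + c) * l <= - (a * d).
Proof.
move=> ab b0 c0 cd len; rewrite !in_itv /= => -[] /andP[? ?]; apply/andP; split; nra.
Qed.

(** The vector [u] is chosen so that [v - A u = p(A T) v], where [p] is the affine
function of [l ^ 2 - (b + c) l] that sends [|bc|] to the claimed factor, [|ad|]
to its opposite, and [0] to [1].  The value [1] at [l = 0] is what makes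
[p(A T) v] of the form [v - A u]. *)
Lemma span_step_bound {R : realType} {n' : nat} (A T : 'M[R]_n'.+1)
    (v : 'cV[R]_n'.+1) (a b c d : R) :
  spdmx T -> A^T = A -> a <= b -> b < 0 -> 0 < c -> c <= d -> b - a = d - c ->
  (forall l : R, eigenvalue (T *m A) l -> l \in `[a, b] \/ l \in `[c, d]) ->
  exists2 u : 'cV[R]_n'.+1, u \in <<[:: T *m v; T *m A *m T *m v]>>%VS &
    normT T (v - A *m u) <=
      (`|a * d| - `|b * c|) / (`|a * d| + `|b * c|) * normT T v.
Proof.
move=> Tspd A_sym ab b0 c0 cd len spec.
have ad_abs : `|a * d| = - (a * d) by apply: normr_mulNP; lra.
have bc_abs : `|b * c| = - (b * c) by exact: normr_mulNP.
have bc_gt0 : 0 < - (b * c) by nra.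
have ad_gt0 : 0 < - (a * d) by nra.
pose k : R := 2 / (`|a * d| + `|b * c|).
have abs_neq0 : - (a * d) + - (b * c) != 0 by rewrite gt_eqF// addr_gt0.
have k_ge0 : 0 <= k by rewrite /k ad_abs bc_abs divr_ge0//; lra.
have rhoE : (`|a * d| - `|b * c|) / (`|a * d| + `|b * c|) =
    1 - k * - (b * c).
  by rewrite /k ad_abs bc_abs; field.
have rhoNE : - ((`|a * d| - `|b * c|) / (`|a * d| + `|b * c|)) =
    1 - k * - (a * d).
  by rewrite /k ad_abs bc_abs; field.
pose p : {poly R} := 1 - k *: ('X * 'X - (b + c) *: 'X).
have GT : T *m A *m T = T *m (T *m A)^T.
  by rewrite trmx_mul A_sym (proj1 Tspd) mulmxA.
have horner_pE : horner_mx (T *m A) p =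
    1%:M - k *: (T *m A *m (T *m A) - (b + c) *: (T *m A)).
  rewrite /p {p k_ge0 rhoE rhoNE}; move: k => t.
  rewrite -!mul_polyC !(rmorphB, rmorphM) rmorph1 /= horner_mx_X !horner_mx_C.
  by rewrite -![_%:M * _]/(_%:M *m _) !mul_scalar_mx.
exists (k *: (T *m A *m T *m v - (b + c) *: (T *m v))).
  by rewrite rpredZ// rpredB ?rpredZ// memv_span// !inE eqxx ?orbT.
have -> : v - A *m (k *: (T *m A *m T *m v - (b + c) *: (T *m v))) =
    (horner_mx (T *m A) p)^T *m v.
  rewrite horner_pE.
  have -> : (1%:M - k *: (T *m A *m (T *m A) - (b + c) *: (T *m A)))^T =
      1%:M - k *: (A *m T *m (A *m T) - (b + c) *: (A *m T)).
    rewrite linearB /= linearZ /= linearB /= [(_ *: _)^T]linearZ /= trmx1.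
    by rewrite !trmx_mul A_sym (proj1 Tspd).
  rewrite mulmxBl mul1mx -scalemxAl -scalemxAr mulmxBl mulmxBr.
  by rewrite -scalemxAl -scalemxAr !mulmxA.
apply: selfadj_horner_normT_le => // l /spec.
move=> /(two_interval_quadratic_bound a b c d l ab b0 c0 cd len) /andP[w_ge w_le].
rewrite ler_norml rhoNE rhoE /p !hornerE -expr2.
by rewrite !lerD2l !lerN2 !ler_wpM2l.
Qed.

Theorem corollary1 (R : realType) (n : nat) (A T : 'M[R]_n) (f : 'cV[R]_n)
    (a b c d : R) (x r : nat -> 'cV[R]_n) (alpha beta : nat -> R)
    (A_nonsing : A \in unitmx) (A_sym : A^T = A) (A_indef : indefinitemx A)
    (T_spd : spdmx T)
    (le_ab : a <= b) (b_lt0 : b < 0) (c_gt0 : 0 < c) (le_cd : c <= d)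
    (eq_len : b - a = d - c)
    (spec_TA : forall l : R, eigenvalue (T *m A) l ->
       l \in `[a, b] \/ l \in `[c, d])
    (r_def : forall i : nat, r i = f - A *m x i)
    (x_step : forall i : nat,
       x i.+1 = x i + beta i *: (T *m r i) + alpha i *: (T *m A *m T *m r i))
    (r_min : forall i : nat,
       is_minimum
         [set normT T (r i - A *m u) |
            u in [set u : 'cV[R]_n |
                    u \in <<[:: T *m r i; T *m A *m T *m r i]>>%VS]]
         (normT T (r i.+1))) :
  (x i @[i --> \oo] --> invmx A *m f) /\
  (forall i : nat, r i != 0 ->
     normT T (r i.+1) / normT T (r i) <=
       (`|a * d| - `|b * c|) / (`|a * d| + `|b * c|)).
Proof.
have ad_abs : `|a * d| = - (a * d) by apply: normr_mulNP; lra.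
have bc_abs : `|b * c| = - (b * c) by exact: normr_mulNP.
set rho := _ / _.
have bc_gt0 : 0 < - (b * c) by nra.
have ad_ge : - (b * c) <= - (a * d) by nra.
have rho_ge0 : 0 <= rho.
  by rewrite /rho ad_abs bc_abs divr_ge0//; lra.
have rho_lt1 : rho < 1.
  by rewrite /rho ad_abs bc_abs ltr_pdivrMr; lra.
have contract i : normT T (r i.+1) <= rho * normT T (r i).
  have [u u_span ui_le] : exists2 u : 'cV[R]_n,
      u \in <<[:: T *m r i; T *m A *m T *m r i]>>%VS &
      normT T (r i - A *m u) <= rho * normT T (r i).
    (* an indefinite matrix has positive size *)
    case: n A T {f x r_def x_step r_min} r A_sym A_indef T_spd spec_TA
      {A_nonsing} => [|n'] A T r A_sym A_indef T_spd spec_TA.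
      case: A_indef => -[l _ /eigenvalueP[v _]].
      by rewrite thinmx0 eqxx.
    exact: span_step_bound.
  apply: le_trans ui_le; apply: (proj2 (r_min i)).
  by exists u.
split.
  have decay k : normT T (r k) <= rho ^+ k * normT T (r 0%N).
    elim: k => [|k IH]; first by rewrite expr0 mul1r.
    by rewrite exprS -mulrA (le_trans (contract k))// ler_wpM2l.
  have norm0 : normT T (r k) @[k --> \oo] --> 0.
    apply: (@squeeze_cvgr _ _ _ _ (fun=> 0)
      (fun k => rho ^+ k * normT T (r 0%N))).
    - by apply: nearW => k; rewrite normT_ge0 decay.
    - exact: cvg_cst.
    - rewrite -[X in _ --> X](mul0r (normT T (r 0%N))).
      by apply: cvgMl; apply: cvg_expr; rewrite ger0_norm.
  have -> : x = (fun k => invmx A *m f - invmx A *m r k).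
    by apply/funext => k; rewrite r_def mulmxBr mulKmx// opprB addrC subrK.
  rewrite -[X in _ --> X]subr0; apply: cvgB; first exact: cvg_cst.
  exact: (normT_cvg0 T).
move=> i ri0; rewrite ler_pdivrMr// lt_neqAle normT_ge0 andbT eq_sym.
apply/eqP => ri_norm0; case/eqP: ri0; apply: (spd_eq0 T) => //.
by rewrite -sqr_normT// ri_norm0 expr0n.
Qed.
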